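(* Let $f_1,\ldots,f_{11}$ be eleven (distinct) monomials chosen among $$x^3y,\ x^3z,\ x^3t,\ xy^3,\ xz^3,\ xt^3,\ y^3z,\ y^3t,\ yz^3,\ yt^3,\ z^3t,\ zt^3,\ x^2y^2,\ z^2t^2,\ y^2z^2,\ x^2t^2 .$$ Then the ideal $I=(x^4,y^4,z^4,t^4,f_1,\ldots,f_{11})\subset\mathbb{C}[x,y,z,t]$ fails the WLP in degree $3$.
   Context: For an artinian homogeneous ideal $I$ in $R=\mathbb{C}[x,y,z,t]$, put $A=R/I=\bigoplus_jA_j$. $I$ fails the WLP (Weak Lefschetz Property) in degree $j$ if for every linear form $L$ the multiplication map $\times L:A_j\to A_{j+1}$ does not have maximal rank (i.e. is neither injective nor surjective). *)

(* Defs.v *)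
From HB Require Import structures.
From mathcomp Require Import all_boot all_order all_algebra.
From mathcomp Require Import boolp reals.
From mathcomp Require Import complex.
From mathcomp Require Import mpoly.

Set Implicit Arguments.
Unset Strict Implicit.
Unset Printing Implicit Defensive.

Import GRing.Theory.

Local Open Scope ring_scope.
Local Open Scope quotient_scope.

Section WeakLefschetz.

Variables (K : fieldType) (n : nat).
Implicit Types (I : idealr {mpoly K[n]}) (gs : seq {mpoly K[n]}).

Definition generated_by I gs : Prop :=
  forall p : {mpoly K[n]},
    p \in I <->
    exists c : 'I_(size gs) -> {mpoly K[n]}, p = \sum_i c i * gs`_i.

(* [idealr] only covers proper ideals; this is why the generators are asked
   to vanish at the origin. *)
Lemma generated_by_exists gs :
  (forall g, g \in gs -> g@_0%MM = 0) -> exists I, generated_by I gs.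
Proof.
move=> gs0.
pose S : {pred {mpoly K[n]}} := fun p =>
  `[< exists c : 'I_(size gs) -> {mpoly K[n]}, p = \sum_i c i * gs`_i >].
have SP p : p \in S <->
    exists c : 'I_(size gs) -> {mpoly K[n]}, p = \sum_i c i * gs`_i.
  by rewrite unfold_in; split=> /asboolP.
have idS : idealr_closed S.
  split.
  - apply/SP; exists (fun=> 0); rewrite big1 // => i _; exact: mul0r.
  - apply/negP => /SP[c]; move/(congr1 (mcoeff 0%MM)).
    rewrite mcoeff1 eqxx raddf_sum /= big1 => [/eqP|i _]; first by rewrite oner_eq0.
    by rewrite (mcoeff0_is_multiplicative _ _).1 (gs0 _ (mem_nth 0 (ltn_ord i))) mulr0.
  - move=> a u v /SP[c ->] /SP[d ->]; apply/SP; exists (fun i => a * c i + d i).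
    by rewrite mulr_sumr -big_split; apply: eq_bigr => i _; rewrite mulrDl mulrA.
pose M := isIdealr.Build {mpoly K[n]} S idS.
pose I : idealr {mpoly K[n]} := HB.pack S M.
by exists I.
Qed.

(* The component A_j of A = K[X]/I, for a homogeneous ideal I. *)
Definition graded_piece I (j : nat) (a : {ideal_quot I}) : Prop :=
  exists2 p : {mpoly K[n]}, p \is j.-homog & a = \pi p.

Definition mul_injective I (L : {mpoly K[n]}) (j : nat) : Prop :=
  forall a b : {ideal_quot I}, graded_piece j a -> graded_piece j b ->
    \pi L * a = \pi L * b -> a = b.

Definition mul_surjective I (L : {mpoly K[n]}) (j : nat) : Prop :=
  forall b : {ideal_quot I}, graded_piece j.+1 b ->
    exists2 a : {ideal_quot I}, graded_piece j a & \pi L * a = b.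

Definition has_maximal_rank I (L : {mpoly K[n]}) (j : nat) : Prop :=
  mul_injective I L j \/ mul_surjective I L j.

Definition fails_WLP I (j : nat) : Prop :=
  forall L : {mpoly K[n]}, L \is 1.-homog -> ~ has_maximal_rank I L j.

End WeakLefschetz.

Section Monomials.

Variable K : fieldType.

Local Notation x := ('X_(@Ordinal 4 0 isT) : {mpoly K[4]}).
Local Notation y := ('X_(@Ordinal 4 1 isT) : {mpoly K[4]}).
Local Notation z := ('X_(@Ordinal 4 2 isT) : {mpoly K[4]}).
Local Notation t := ('X_(@Ordinal 4 3 isT) : {mpoly K[4]}).

Definition fourth_powers : seq {mpoly K[4]} :=
  [:: x ^+ 4; y ^+ 4; z ^+ 4; t ^+ 4].

Definition candidate_monomials : seq {mpoly K[4]} :=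
  [:: x ^+ 3 * y; x ^+ 3 * z; x ^+ 3 * t; x * y ^+ 3; x * z ^+ 3; x * t ^+ 3;
      y ^+ 3 * z; y ^+ 3 * t; y * z ^+ 3; y * t ^+ 3; z ^+ 3 * t; z * t ^+ 3;
      x ^+ 2 * y ^+ 2; z ^+ 2 * t ^+ 2; y ^+ 2 * z ^+ 2; x ^+ 2 * t ^+ 2].

End Monomials.

(* Main.v *)
Require Import Defs.
From mathcomp Require Import all_boot all_order all_algebra.
From mathcomp Require Import reals.
From mathcomp Require Import complex.
From mathcomp Require Import mpoly.
From mathcomp Require Import ring zify.

(** Let L = ax + by + cz + dt. There are 35 quartic monomials, 4 + 16 of which
    can be generators of I, so 15 monomials survive in A_4 whatever the choice
    of f. The coefficients of L q at these 15 monomials satisfy one linear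
    relation valid for all cubics q; hence L A_3 is a proper subspace of A_4.
    As A_3 and A_4 both have dimension 20, multiplication by L is then not
    injective either: a cubic p for which L p vanishes at 19 of the 20 monomials
    of A_4 exists by counting dimensions, and the relation gives the 20th. *)

Import GRing.Theory Num.Theory.

Local Open Scope ring_scope.

(** * Coefficients of products, and ideals generated by monomials *)

Section MultivariatePolynomials.

Context {n : nat} {K : fieldType}.
Implicit Types (p q L : {mpoly K[n]}) (m u : 'X_{1..n}) (s t : seq 'X_{1..n}).

Lemma mcoeffXM u q m :
  ('X_[u] * q)@_m = if (u <= m)%MM then q@_(m - u)%MM else 0.
Proof.
rewrite mulrC; case: ifPn => [le_um|nle_um].
  by rewrite -{1}(submK le_um) addmC mcoeffMX.
apply: contraNeq nle_um; rewrite -mcoeff_msupp => /msuppM_le /allpairsP[[m1 m2]].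
by rewrite /= msuppX inE => -[_ /eqP -> ->]; rewrite lem_addl.
Qed.

Lemma mcoeff_linearM L q m : L \is 1.-homog ->
  (L * q)@_m =
  \sum_i L@_U_(i) * (if (0 < m i)%N then q@_(m - U_(i))%MM else 0).
Proof.
move=> homL.
have defL : L = \sum_i L@_U_(i) *: 'X_i.
  apply/mpolyP => u; rewrite raddf_sum /=.
  under eq_bigr do rewrite mcoeffZ mcoeffX.
  have [/mdeg1P[i /eqP->]|u1] := boolP (mdeg u == 1%N).
    rewrite (bigD1 i) //= eqxx mulr1 big1 ?addr0 // => j ij.
    by rewrite eq_mnm1 (negPf ij) mulr0.
  rewrite (dhomog_nemf_coeff homL u1) big1 // => i _.
  by case: (U_(i)%MM =P u) u1 => [<-|]; rewrite ?mdeg1 // mulr0.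
rewrite [in LHS]defL mulr_suml raddf_sum /=; apply: eq_bigr => i _.
by rewrite -scalerAl mcoeffZ mcoeffXM lep1mP -lt0n.
Qed.

(** The conditions are [size t] homogeneous linear equations in the [size s] coefficients of p. A
    nonzero solution is a vector of the left kernel of M, whose rank is at most [size t]. *)
Lemma exists_mul_mcoeff0 L s t : uniq s -> (size t < size s)%N ->
  exists p, [/\ p != 0, {subset msupp p <= s}
              & forall m, m \in t -> (L * p)@_m = 0].
Proof.
move=> us lt_ts.
pose M := \matrix_(i < size s, j < size t)
  (L * 'X_[nth 0%MM s i])@_(nth 0%MM t j).
have /rowV0Pn[v /sub_kermxP vM v0] : kermx M != 0.
  by rewrite -mxrank_eq0 mxrank_ker -lt0n subn_gt0 (leq_ltn_trans (rank_leq_col M)).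
pose p : {mpoly K[n]} := \sum_(i < size s) v 0 i *: 'X_[nth 0%MM s i].
have coefp m : p@_m = \sum_(i < size s) v 0 i * (nth 0%MM s i == m)%:R.
  by rewrite raddf_sum; apply: eq_bigr => i _; rewrite /= mcoeffZ mcoeffX.
exists p; split.
- apply: contraNneq v0 => p0; apply/eqP/rowP => i.
  have := coefp (nth 0%MM s i); rewrite p0 mcoeff0 (bigD1 i) //= eqxx mulr1.
  rewrite big1 ?addr0 => [<-|j ji]; first by rewrite mxE.
  by rewrite nth_uniq // (inj_eq val_inj) (negPf ji) mulr0.
- move=> m; apply: contraTT => ms.
  rewrite -mcoeff_eq0 coefp big1 // => i _.
  by case: eqP ms => [<-|_]; rewrite ?mem_nth // mulr0.
- move=> _ /(nthP 0%MM)[j jt <-].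
  have := congr1 (fun w : 'rV_(size t) => w 0 (Ordinal jt)) vM.
  rewrite !mxE => <-; rewrite mulr_sumr raddf_sum /=.
  by apply: eq_bigr => i _; rewrite mxE -scalerAr mcoeffZ.
Qed.

Section MonomialIdeal.

Variables (I : idealr {mpoly K[n]}) (us : seq 'X_{1..n}).
Hypothesis I_gen : generated_by I [seq 'X_[u] | u <- us].

Lemma monomial_ideal_mcoeff0 p m :
  p \in I -> (forall u, u \in us -> ~~ (u <= m)%MM) -> p@_m = 0.
Proof.
move=> /I_gen[c ->] ndiv; rewrite raddf_sum big1 //= => i _.
have lti : (i < size us)%N by rewrite -(size_map (fun u => 'X_[u] : {mpoly K[n]})) ltn_ord.
by rewrite (nth_map 0%MM) // mulrC mcoeffXM (negPf (ndiv _ _)) // mem_nth.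
Qed.

Lemma mem_monomial_ideal p : {subset msupp p <= us} -> p \in I.
Proof.
move=> sub; rewrite (mpolyE p) big_seq; apply: rpred_sum => m /sub mus.
rewrite -mul_mpolyC idealMr //; apply/I_gen.
have ltm : (index m us < size [seq 'X_[u] : {mpoly K[n]} | u <- us])%N.
  by rewrite size_map index_mem.
exists (fun i => (i == Ordinal ltm)%:R).
rewrite (bigD1 (Ordinal ltm)) //= eqxx mul1r big1 ?addr0 => [|i /negPf ->].
  by rewrite (nth_map 0%MM) ?index_mem // nth_index.
by rewrite mul0r.
Qed.

End MonomialIdeal.

Lemma pi_eqP (I : idealr {mpoly K[n]}) p q :
  \pi_({ideal_quot I})%qT p = \pi_({ideal_quot I})%qT q <-> p - q \in I.
Proof. by rewrite Quotient.idealrBE; split=> [/eqP|/eqP]. Qed.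

End MultivariatePolynomials.

(** * Monomials in four variables *)

Definition mon (i j k l : nat) : 'X_{1..4} := [multinom [tuple i; j; k; l]].
Arguments mon : simpl never.

(** An explicit list, so that counts, uniqueness and membership are settled by computation. *)
Definition monomials (d : nat) : seq 'X_{1..4} :=
  [seq mon e.1 e.2.1 e.2.2 (d - e.1 - e.2.1 - e.2.2) |
    e <- [seq (i, jk) | i <- iota 0 d.+1,
           jk <- [seq (j, k) | j <- iota 0 (d - i).+1, k <- iota 0 (d - i - j).+1]]].

Lemma monE (m : 'X_{1..4}) :
  m = mon (m (@Ordinal 4 0 isT)) (m (@Ordinal 4 1 isT))
          (m (@Ordinal 4 2 isT)) (m (@Ordinal 4 3 isT)).
Proof.
apply/mnmP; case; do 4![case=> [lt|]; first by
  rewrite [RHS]/(tnth _ _) /=; congr (m _); apply: val_inj].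
by [].
Qed.

Lemma mdeg_mon i j k l : mdeg (mon i j k l) = (i + j + k + l)%N.
Proof. by rewrite mdegE !big_ord_recl big_ord0 /= addn0 !addnA. Qed.

Lemma mem_monomials d m : (m \in monomials d) = (mdeg m == d).
Proof.
apply/mapP/eqP => [[[i [j k]]]|].
  case/allpairsPdep=> i' [[j' k'] [+ + [-> -> ->]]].
  rewrite mem_iota => hi /allpairsPdep[j'' [k'' [+ + [-> ->]]]].
  by rewrite !mem_iota => hj hk ->; rewrite mdeg_mon /=; lia.
rewrite (monE m) mdeg_mon; move: (m _) (m _) (m _) (m _) => l k j i <-.
exists (i, (j, k)); last by congr mon; rewrite /=; lia.
apply: (allpairs_f_dep (fun i (jk : nat * nat) => (i, jk))).
  by rewrite mem_iota; lia.
by apply: (allpairs_f_dep (fun j k : nat => (j, k))); rewrite mem_iota; lia.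
Qed.

Definition fourth_power_mons := [:: mon 4 0 0 0; mon 0 4 0 0; mon 0 0 4 0; mon 0 0 0 4].

Definition candidate_mons :=
  [:: mon 3 1 0 0; mon 3 0 1 0; mon 3 0 0 1; mon 1 3 0 0; mon 1 0 3 0; mon 1 0 0 3;
      mon 0 3 1 0; mon 0 3 0 1; mon 0 1 3 0; mon 0 1 0 3; mon 0 0 3 1; mon 0 0 1 3;
      mon 2 2 0 0; mon 0 0 2 2; mon 0 2 2 0; mon 2 0 0 2].

Definition remaining_mons :=
  [seq m <- monomials 4 | m \notin fourth_power_mons ++ candidate_mons].

(** What a linear relation with nonzero weight at m0 yields. It keeps the class of m0 out of the
    image of L, and saves one equation in the search for a kernel element. *)
Definition dependent_mcoeff {K : fieldType} (L : {mpoly K[4]}) (m0 : 'X_{1..4}) :=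
  forall q, {in remaining_mons, forall m, m != m0 -> (L * q)@_m = 0} ->
  (L * q)@_m0 = 0.

(** * The linear relation between the coefficients of multiples of L *)

Section LinearForm.

Context {K : fieldType}.
Variable L : {mpoly K[4]}.
Hypothesis homL : L \is 1.-homog.

Local Notation a := L@_U_(@Ordinal 4 0 isT).
Local Notation b := L@_U_(@Ordinal 4 1 isT).
Local Notation c := L@_U_(@Ordinal 4 2 isT).
Local Notation d := L@_U_(@Ordinal 4 3 isT).

(* r i j k l is the coefficient of q at mon i j k l, kept abstract because [ring]
   would compare the atoms q@_m by unfolding [mcoeff]. *)
Lemma mcoeff_linear_mon (q : {mpoly K[4]}) :
  exists r : nat -> nat -> nat -> nat -> K, forall i j k l, (L * q)@_(mon i j k l) =
    a * (if i is i'.+1 then r i' j k l else 0) +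
    b * (if j is j'.+1 then r i j' k l else 0) +
    c * (if k is k'.+1 then r i j k' l else 0) +
    d * (if l is l'.+1 then r i j k l' else 0).
Proof.
exists (fun i j k l => q@_(mon i j k l)) => i j k l.
rewrite (mcoeff_linearM L _ _ homL) !big_ord_recl big_ord0 addr0 !addrA.
have pred (o : 'I_4) (m m' : 'X_{1..4}) : m = (U_(o) + m')%MM ->
    (if (0 < m o)%N then q@_(m - U_(o))%MM else 0) = q@_m'.
  by move=> ->; rewrite mnmDE mnm1E eqxx addmC addmK.
congr (_ * _ + _ * _ + _ * _ + _ * _).
- case: i => [//|i]; apply: (pred ord0 (mon i.+1 j k l)).
  by apply/mnmP; case=> [[|[|[|[|o]]]]] //= lto; rewrite mnmDE mnm1E.
- case: j => [//|j]; apply: (pred (lift ord0 ord0) (mon i j.+1 k l)).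
  by apply/mnmP; case=> [[|[|[|[|o]]]]] //= lto; rewrite mnmDE mnm1E.
- case: k => [//|k]; apply: (pred (lift ord0 (lift ord0 ord0)) (mon i j k.+1 l)).
  by apply/mnmP; case=> [[|[|[|[|o]]]]] //= lto; rewrite mnmDE mnm1E.
- case: l => [//|l].
  apply: (pred (lift ord0 (lift ord0 (lift ord0 ord0))) (mon i j k l.+1)).
  by apply/mnmP; case=> [[|[|[|[|o]]]]] //= lto; rewrite mnmDE mnm1E.
Qed.

Lemma relation_dependent_mcoeff (ws : seq (K * 'X_{1..4})) :
  uniq (unzip2 ws) -> all (mem remaining_mons) (unzip2 ws) ->
  has (fun e => e.1 != 0) ws -> (forall q, \sum_(e <- ws) e.1 * (L * q)@_e.2 = 0) ->
  exists2 m0, m0 \in remaining_mons & dependent_mcoeff L m0.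
Proof.
move=> uws /allP sub /hasP[[w m0] ws0 /= w0] rel; exists m0 => [|q q0].
  by apply/sub/mapP; exists (w, m0).
have pws := perm_to_rem ws0.
move: uws; rewrite (perm_uniq (perm_map snd pws)) /= => /andP[m0ws _].
have := rel q; rewrite (perm_big _ pws) big_cons /= big_seq big1 => [|e ews].
  by rewrite addr0 => /eqP; rewrite mulf_eq0 (negPf w0) => /eqP.
rewrite q0 ?mulr0 //; first by apply/sub/map_f/(mem_rem ews).
by apply: contraNneq m0ws => em0; rewrite -{1}em0 map_f.
Qed.

(* A linear relation between the coefficients of all multiples of L is a quartic
   G killed by a d/dx + b d/dy + c d/dz + d d/dt, its coefficient at m being
   weighted by m!. The relation proved in [cyc] comes in this way from
   G = (bx - ay)(cy - bz)(dz - ct)(at - dx) / 2, which does not involve x^2y^2,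
   y^2z^2, z^2t^2, x^2t^2 nor any cube of a variable. This G vanishes when two
   cyclically adjacent coefficients of L do; for a = b = 0 it is replaced by
   x^2y (dz - ct), and similarly in the other cases. *)
Lemma exists_dependent_mcoeff : (2 : K) != 0 ->
  exists2 m0, m0 \in remaining_mons & dependent_mcoeff L m0.
Proof.
move=> two_neq0.
have cyc : (b * d != 0) || (a * c != 0) ->
    exists2 m0, m0 \in remaining_mons & dependent_mcoeff L m0.
  move=> nz; apply: (@relation_dependent_mcoeff
   [:: (2 * (b * d) ^+ 2, mon 2 0 2 0); (2 * (a * c) ^+ 2, mon 0 2 0 2);
       (a * b * c * d, mon 1 1 1 1);
       (- (a * b * c ^+ 2), mon 1 1 0 2); (- (a * b ^+ 2 * d), mon 1 0 2 1);
       (a * b ^+ 2 * c, mon 1 0 1 2); (- (b * c * d ^+ 2), mon 2 1 1 0);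
       (b * c ^+ 2 * d, mon 2 1 0 1); (- (b ^+ 2 * c * d), mon 2 0 1 1);
       (- (a ^+ 2 * c * d), mon 0 2 1 1); (a ^+ 2 * b * d, mon 0 1 2 1);
       (- (a ^+ 2 * b * c), mon 0 1 1 2); (a * c * d ^+ 2, mon 1 2 1 0);
       (- (a * c ^+ 2 * d), mon 1 2 0 1); (- (a * b * d ^+ 2), mon 1 1 2 0)]).
  - by [].
  - by [].
  (* The weight at x^2z^2 or the one at y^2t^2 is nonzero, by characteristic other than 2. *)
  - by case/orP: nz => /(expf_neq0 2)/(mulf_neq0 two_neq0) nz; rewrite /= nz ?orbT.
  - move=> q; have [r rE] := mcoeff_linear_mon q.
    rewrite !big_cons big_nil /= !rE.
    move: a b c d => {nz rE} a b c d; ring.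
have [/and4P[/eqP a0 /eqP b0 /eqP c0 /eqP d0]|] :=
    boolP [&& a == 0, b == 0, c == 0 & d == 0].
  (* For L = 0 any remaining monomial does; xyzt is one. *)
  apply: (@relation_dependent_mcoeff [:: (1, mon 1 1 1 1)]); rewrite //= ?oner_neq0 //.
  move=> q; have [r rE] := mcoeff_linear_mon q.
  by rewrite big_seq1 rE a0 b0 c0 d0 /=; ring.
have [nz _|] := boolP ((b * d != 0) || (a * c != 0)); first exact: cyc.
have adj e1 e2 f1 f2 : (e1 != 0) || (e2 != 0) -> f1 != f2 ->
    f1 \in remaining_mons -> f2 \in remaining_mons ->
    (forall q, e1 * (L * q)@_f1 = e2 * (L * q)@_f2) ->
    exists2 m0, m0 \in remaining_mons & dependent_mcoeff L m0.
  move=> nz f12 f1r f2r rel.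
  apply: (@relation_dependent_mcoeff [:: (e1, f1); (- e2, f2)]).
  - by rewrite /= inE f12.
  - by rewrite /= f1r f2r.
  - by rewrite /= oppr_eq0 orbF.
  - by move=> q; rewrite !big_cons big_nil addr0 /= rel mulNr subrr.
rewrite negb_or !negbK !mulf_eq0.
(* The cases are a = b = 0, b = c = 0, a = d = 0 and c = d = 0. In each, the two quartics are the
   products of one cubic in the two variables absent from L with the other two variables, so both
   coefficients are multiples of the coefficient of q at that cubic. *)
move=> /andP[/orP[]/eqP z1 /orP[]/eqP z2]; rewrite z1 z2 eqxx /= ?negb_and ?orbF => nz;
  [ apply: (adj c d (mon 2 1 0 1) (mon 2 1 1 0))
  | apply: (adj a d (mon 0 2 1 1) (mon 1 2 1 0))
  | apply: (adj b c (mon 1 0 1 2) (mon 1 1 0 2))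
  | apply: (adj a b (mon 0 1 1 2) (mon 1 0 1 2)) ] => // q;
  have [r rE] := mcoeff_linear_mon q; rewrite !rE z1 z2 /=;
  by move: a b c d => {adj cyc nz rE z1 z2} a b c d; ring.
Qed.

End LinearForm.

(** * Failure of the WLP *)

Lemma mpolyX_mon (K : fieldType) i j k l :
  'X_[mon i j k l] =
    'X_(@Ordinal 4 0 isT) ^+ i * 'X_(@Ordinal 4 1 isT) ^+ j *
    'X_(@Ordinal 4 2 isT) ^+ k * 'X_(@Ordinal 4 3 isT) ^+ l :> {mpoly K[4]}.
Proof.
rewrite mpolyXE_id !big_ord_recl big_ord0 mulr1 !mulrA.
by congr (_ * _ * _ * _); congr ('X_[U_(_)] ^+ _); apply: val_inj.
Qed.

Lemma fourth_powersE (K : fieldType) :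
  fourth_powers K = [seq 'X_[m] | m <- fourth_power_mons].
Proof. by rewrite /= !mpolyX_mon !expr0 !(mul1r, mulr1). Qed.

Lemma candidate_monomialsE (K : fieldType) :
  candidate_monomials K = [seq 'X_[m] | m <- candidate_mons].
Proof. by rewrite /= !mpolyX_mon !expr0 !expr1 !(mul1r, mulr1). Qed.

Theorem monomial_fails_WLP (K : fieldType) (us : seq 'X_{1..4}) (I : idealr {mpoly K[4]}) :
  (2 : K) != 0 -> uniq us -> size us = 15%N ->
  {subset us <= fourth_power_mons ++ candidate_mons} ->
  generated_by I [seq 'X_[u] | u <- us] -> fails_WLP I 3.
Proof.
move=> two_neq0 us_uniq us_size us_sub I_gen L homL.
have [m0 m0r dep] := exists_dependent_mcoeff L homL two_neq0.
have deg4 u : u \in us -> mdeg u = 4%N.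
  by move=> /us_sub uin; apply/eqP; rewrite -mem_monomials; apply: (allP _ u uin).
have rem_us m : m \in remaining_mons -> m \notin us /\ mdeg m = 4%N.
  rewrite mem_filter mem_monomials => /andP[mn /eqP ->]; split=> //.
  by apply: contra mn => /us_sub.
(* All generators are quartic, so one dividing a monomial of degree at most 4 equals it. *)
have mcoeffI p m : p \in I -> (mdeg m <= 4)%N -> m \notin us -> p@_m = 0.
  move=> pI m4 mus; apply: (monomial_ideal_mcoeff0 I us I_gen) => // u uus.
  apply: contra mus => le_um.
  have : (mdeg (m - u) + mdeg u)%N = mdeg m by rewrite -mdegD submK.
  rewrite (deg4 _ uus) => degm; have : mdeg (m - u) == 0%N by lia.
  by rewrite mdeg_eq0 => /eqP mu0; rewrite -(submK le_um) mu0 add0m.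
have dim4 : size (monomials 4) = 35%N by [].
(* These 35 - 16 equations are one fewer than the 20 coefficients of a cubic. *)
have size_coefs : size [seq m <- monomials 4 | m \notin m0 :: us] = 19%N.
  have [m0us m04] := rem_us _ m0r.
  have pm : perm_eq [seq m <- monomials 4 | m \in m0 :: us] (m0 :: us).
    apply: uniq_perm => [||m]; first exact: filter_uniq.
      by rewrite cons_uniq m0us.
    rewrite mem_filter mem_monomials andb_idr // inE => /orP[/eqP->|/deg4->//].
    by rewrite m04.
  have cnt := perm_size pm; rewrite size_filter in cnt.
  have := count_predC (mem (m0 :: us)) (monomials 4).
  by rewrite cnt dim4 size_filter [size _]/= us_size => -[].
have outside_I p : p \in I -> p \is 3.-homog -> p = 0.
  move=> pI homp; apply/mpolyP => m; rewrite mcoeff0.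
  have [m3|m3] := eqVneq (mdeg m) 3; last exact: dhomog_nemf_coeff homp m3.
  by apply: mcoeffI => //; rewrite ?m3 //; apply/negP => /deg4; rewrite m3.
case=> [inj|surj].
- have lt_size : (size [seq m <- monomials 4 | m \notin m0 :: us] < size (monomials 3))%N.
    by rewrite size_coefs.
  have uniq3 : uniq (monomials 3) by [].
  have [p [p_neq0 psub pcoef]] := exists_mul_mcoeff0 L _ _ uniq3 lt_size.
  have homp : p \is 3.-homog.
    by apply/dhomogP => m /psub; rewrite mem_monomials => /eqP.
  have /dhomogP homLp : L * p \is 4.-homog := dhomogM homL homp.
  have LpI : L * p \in I.
    apply: (mem_monomial_ideal I us I_gen) => m mLp; apply: contraLR (mLp) => mus.
    rewrite -mcoeff_eq0; apply/eqP.
    (* At m0 the coefficient vanishes by the relation, elsewhere by the choice of p. *)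
    have [->|mm0] := eqVneq m m0.
      apply: dep => m' m'r m'm0; apply: pcoef.
      rewrite mem_filter inE (negPf m'm0) mem_monomials.
      by have [-> ->] := rem_us _ m'r.
    apply: pcoef.
    by rewrite mem_filter inE (negPf mm0) mus mem_monomials (homLp _ mLp).
  move/eqP: p_neq0; apply; apply: outside_I => //.
  rewrite -[p]subr0; apply/pi_eqP/inj.
  + by exists p.
  + by exists 0; rewrite ?dhomog0.
  + by rewrite -!rmorphM mulr0; apply/pi_eqP; rewrite subr0.
- have [m0us m04] := rem_us _ m0r.
  have /surj[_ [q homq ->]] : graded_piece 4 (\pi_({ideal_quot I})%qT 'X_[m0]).
    by exists 'X_[m0] => //; rewrite dhomogX; apply/eqP.
  rewrite -rmorphM => /pi_eqP LqI.
  (* So L q has coefficient 1 at m0 and 0 at the other remaining monomials, against [dep]. *)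
  have Lq m : mdeg m = 4%N -> m \notin us -> (L * q)@_m = (m0 == m)%:R.
    move=> m4 mus; apply/eqP; rewrite -mcoeffX -subr_eq0 -mcoeffB; apply/eqP.
    by apply: mcoeffI; rewrite ?m4.
  have := dep q; rewrite Lq // eqxx => one0.
  suff /eqP : (1 : K) = 0 by rewrite oner_eq0.
  by apply: one0 => m /rem_us[mus m4] mm0; rewrite Lq // eq_sym (negPf mm0).
Qed.

Theorem proposition6p5 (R : realType) (f : 11.-tuple {mpoly R[i][4]})
    (f_uniq : uniq f)
    (f_cand : {subset f <= candidate_monomials R[i]})
    (I : idealr {mpoly R[i][4]})
    (I_gen : generated_by I (fourth_powers R[i] ++ f)) :
  fails_WLP I 3.
Proof.
move: f_cand I_gen; rewrite candidate_monomialsE fourth_powersE => f_cand I_gen.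
(* Leading exponents recover the exponent vectors of the given monomials. *)
have mleadK : {in f, cancel (@mlead 4 R[i]) (fun m => 'X_[m] : {mpoly R[i][4]})}.
  by move=> g /f_cand/mapP[m _ ->]; rewrite mleadXm.
pose fm := [seq mlead g | g <- f].
have fE : f = [seq 'X_[m] | m <- fm] :> seq _ by rewrite -map_comp map_id_in.
have fm_sub : {subset fm <= candidate_mons}.
  by move=> _ /mapP[g /f_cand/mapP[m mc ->] ->]; rewrite mleadXm.
apply: (@monomial_fails_WLP _ (fourth_power_mons ++ fm)).
- by rewrite pnatr_eq0.
- rewrite cat_uniq; apply/and3P; split=> //.
    have /allP disj : all (fun m => m \notin fourth_power_mons) candidate_mons by [].
    by apply/hasPn => m /fm_sub/disj.
  by apply: (@map_uniq _ _ (fun m => 'X_[m] : {mpoly R[i][4]})); rewrite -fE.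
- by rewrite size_cat size_map size_tuple.
- by move=> m; rewrite !mem_cat => /orP[->//|/fm_sub->]; rewrite orbT.
- by rewrite map_cat -fE.
Qed.
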